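(* Let $A$ and $B$ be groups containing elements of infinite order $x_1\in A$, $x_2\in B$, and let $G=A\ast B$ be their free product. If $\mathrm{Rat}(A)$ and $\mathrm{Rat}(B)$ are Boolean algebras, then for every proper word $w$ with $e(w)\geq 2$ the set $w[G]$ is not rational in $G$.
   Context: A word is an element $w=w(x_1,\dots,x_n)$ of the free group $F(X)$ with basis $X=\{x_1,x_2,\dots\}$. For a group $G$, $w[G]=\{w(g_1,\dots,g_n) : g_1,\dots,g_n\in G\}$. The word $w$ is proper if there exist groups $G$ and $H$ such that $w[G]\neq \{1\}$ and $w[H]\neq H$. Writing $w=x_1^{t_1}\cdots x_n^{t_n}w'$ with $w'\in[F(X),F(X)]$ (so $t_i$ is the exponent sum of $x_i$ in $w$), put $e(w)=\gcd(t_1,\dots,t_n)$, with $e(w)=0$ if all $t_i=0$. For a monoid $M$, the family $\mathrm{Rat}(M)$ of rational subsets of $M$ is the smallest family of subsets of $M$ that contains all finite subsets and is closed under union, product $L_1L_2=\{ab : a\in L_1, b\in L_2\}$, and submonoid generation $L\mapsto L^{\ast}$. A subset of a group $G$ is rational in $G$ if it belongs to $\mathrm{Rat}(G)$. $\mathrm{Rat}(G)$ is a Boolean algebra if it is closed under intersections and complements in $G$ (it is always closed under unions). *)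

(* Defs.v *)
From HB Require Import structures.
From mathcomp Require Import all_boot ssralg ssrint.
From mathcomp Require Import classical_sets functions cardinality.

Set Implicit Arguments.
Unset Strict Implicit.
Unset Printing Implicit Defensive.

Local Open Scope classical_set_scope.
Local Open Scope group_scope.

(* Free group on X: freely reduced words; (x, b) stands for x if b = false    *)
(* and for x^-1 if b = true.                                                  *)

Section FreeGroup.
Variable X : choiceType.
Implicit Types (l m : X * bool) (u v w : seq (X * bool)).

Definition free_inv_letter l := (l.1, ~~ l.2).

Definition freely_reduced w := sorted (fun l m => m != free_inv_letter l) w.

Record free_group := FreeGroup {
  free_word : seq (X * bool);
  free_wordP : freely_reduced free_word }.

HB.instance Definition _ := [isSub for free_word].
HB.instance Definition _ := [Choice of free_group by <:].

(* Reduced form of l :: w, for w reduced. *)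
Definition free_cons l w :=
  if w is m :: w' then if m == free_inv_letter l then w' else l :: w
  else [:: l].

Lemma free_inv_letterK : involutive free_inv_letter.
Proof. by case=> x b; rewrite /free_inv_letter /= negbK. Qed.

Lemma freely_reduced_behead l w : freely_reduced (l :: w) -> freely_reduced w.
Proof. by case: w => //= m w /andP[]. Qed.

Lemma free_cons_reduced l w : freely_reduced w -> freely_reduced (free_cons l w).
Proof.
case: w => //= m w rw; case: ifPn => [_|ml]; first exact: freely_reduced_behead rw.
by rewrite /freely_reduced /= ml.
Qed.

Lemma free_consE l w : freely_reduced (l :: w) -> free_cons l w = l :: w.
Proof. by case: w => //= m w /andP[/negbTE ->]. Qed.

Lemma free_consK l w :
  freely_reduced w -> free_cons l (free_cons (free_inv_letter l) w) = w.
Proof.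
case: w => [|m w] /=; first by rewrite eqxx.
rewrite free_inv_letterK; case: eqVneq => [->|ml] rw /=; last by rewrite eqxx.
by rewrite free_consE.
Qed.

Definition free_mulw u v := foldr free_cons v u.

Lemma free_mulw_reduced u v : freely_reduced v -> freely_reduced (free_mulw u v).
Proof. by move=> rv; elim: u => //= l u; apply: free_cons_reduced. Qed.

Lemma free_mulw_cons l u v : freely_reduced v ->
  free_mulw (free_cons l u) v = free_cons l (free_mulw u v).
Proof.
move=> rv; case: u => //= m u; case: eqP => [->|_] //=.
by rewrite free_consK //; apply: free_mulw_reduced.
Qed.

Lemma free_invw_reduced w :
  freely_reduced w -> freely_reduced (rev (map free_inv_letter w)).
Proof.
rewrite /freely_reduced rev_sorted sorted_map; apply: sub_sorted => l m.
by rewrite /= free_inv_letterK eq_sym.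
Qed.

Definition free_one := FreeGroup (isT : freely_reduced [::]).
Definition free_mul (u v : free_group) :=
  FreeGroup (free_mulw_reduced (free_word u) (free_wordP v)).
Definition free_inv (u : free_group) :=
  FreeGroup (free_invw_reduced (free_wordP u)).

Lemma free_mulA : associative free_mul.
Proof.
move=> u v [w rw]; apply/val_inj; case: u => u ru /=; elim: u {ru} => //= l u ->.
by rewrite free_mulw_cons.
Qed.

Lemma free_mul1 : left_id free_one free_mul.
Proof. by move=> u; apply/val_inj. Qed.

Lemma free_mulr1 : right_id free_one free_mul.
Proof.
move=> [u ru]; apply/val_inj => /=; elim: u ru => //= l u IHu ru.
by rewrite IHu ?free_consE //; apply: freely_reduced_behead ru.
Qed.

Lemma free_mulV : left_inverse free_one free_inv free_mul.
Proof.
move=> [u ru]; apply/val_inj => /=; elim: u ru => //= l u IHu ru.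
rewrite rev_cons /free_mulw foldr_rcons /= free_inv_letterK eqxx.
by apply: IHu; apply: freely_reduced_behead ru.
Qed.

Lemma free_mulrV : right_inverse free_one free_inv free_mul.
Proof.
move=> u; have {1}<- : free_inv (free_inv u) = u; last exact: free_mulV.
apply/val_inj; rewrite /= map_rev revK -map_comp map_id_in // => l _.
exact: free_inv_letterK.
Qed.

HB.instance Definition _ := isGroup.Build free_group
  free_mulA free_mul1 free_mulr1 free_mulV free_mulrV.

Definition free_gen (x : X) : free_group :=
  FreeGroup (isT : freely_reduced [:: (x, false)]).

(* The value w(g) of w under the substitution x |-> g x. *)
Definition free_eval (G : groupType) (g : X -> G) (w : free_group) : G :=
  \prod_(l <- free_word w) (if l.2 then (g l.1)^-1 else g l.1).

Lemma free_eval_gen (G : groupType) (g : X -> G) x :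
  free_eval g (free_gen x) = g x.
Proof. by rewrite /free_eval big_seq1. Qed.

Lemma free_eval_morphism (G : groupType) (g : X -> G) :
  monoid_morphism (free_eval g).
Proof.
rewrite /free_eval; split=> [|[u ru] [v rv]] /=; first by rewrite big_nil.
elim: u ru => [|l u IHu] ru /=; first by rewrite big_nil mul1g.
rewrite big_cons -mulgA -IHu; last exact: freely_reduced_behead ru.
case: (free_mulw u v) => [|m w] /=; first by rewrite big_seq1 big_nil mulg1.
case: eqP => [->|_]; rewrite !big_cons //= mulgA.
by case: (l.2); rewrite ?mulgV ?mulVg mul1g.
Qed.

Lemma free_eval_unique (G : groupType) (g : X -> G) (f : free_group -> G) :
  monoid_morphism f -> (forall x, f (free_gen x) = g x) -> f =1 free_eval g.
Proof.
move=> [f1 fM] fg [w rw]; rewrite /free_eval /=; elim: w rw => [|l w IHw] rw.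
  by rewrite big_nil -f1; congr f; apply/val_inj.
have rw' := freely_reduced_behead rw.
have fV z : f z^-1 = (f z)^-1 by apply: (mulgI (f z)); rewrite -fM !mulgV.
rewrite big_cons.
have <- : f (if l.2 then (free_gen l.1)^-1 else free_gen l.1)
    = if l.2 then (g l.1)^-1 else g l.1 by case: (l.2); rewrite ?fV fg.
rewrite -(IHw rw') -fM; congr f; apply/val_inj.
by rewrite -[LHS](free_consE rw); case: l {rw} => x [].
Qed.

(* The exponent sum of x in w. *)
Definition exponent_sum (w : free_group) (x : X) : int :=
  (\sum_(l <- free_word w | l.1 == x) (-1) ^+ l.2)%R.

(* Variables not occurring in w contribute 0, which is neutral for gcdn. *)
Definition exponent_gcd (w : free_group) : nat :=
  \big[gcdn/0%N]_(l <- free_word w) `|exponent_sum w l.1|%N.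

End FreeGroup.

(* Free product: reduced alternating sequences of nontrivial syllables.       *)

Section FreeProduct.
Variables A B : groupType.
Implicit Types (s t : A + B) (u v w : seq (A + B)).

Definition syl_nontrivial s :=
  match s with inl a => a != 1 | inr b => b != 1 end.

Definition syl_left s := if s is inl _ then true else false.

Definition syl_inv s : A + B :=
  match s with inl a => inl a^-1 | inr b => inr b^-1 end.

Definition fprod_reduced w :=
  all syl_nontrivial w && sorted (fun s t => syl_left s != syl_left t) w.

Record free_product := FreeProduct {
  fprod_word : seq (A + B);
  fprod_wordP : fprod_reduced fprod_word }.

HB.instance Definition _ := [isSub for fprod_word].
HB.instance Definition _ := [Choice of free_product by <:].

(* Reduced form of s :: w, for w reduced. *)
Definition fprod_cons s w :=
  match s, w with
  | inl a, inl a' :: w' => if a * a' == 1 then w' else inl (a * a') :: w'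
  | inr b, inr b' :: w' => if b * b' == 1 then w' else inr (b * b') :: w'
  | _, _ => if syl_nontrivial s then s :: w else w
  end.

Lemma fprod_reduced_behead s w : fprod_reduced (s :: w) -> fprod_reduced w.
Proof.
rewrite /fprod_reduced /= => /andP[/andP[_ ->]] /=.
by case: w => //= t w /andP[].
Qed.

Lemma fprod_cons_reduced s w : fprod_reduced w -> fprod_reduced (fprod_cons s w).
Proof.
case: s w => [a|b] [|[a'|b'] w] //= rw; try by case: ifP => // nt;
  move: rw; rewrite /fprod_reduced /= nt.
all: case: ifPn => [_|nt]; first exact: fprod_reduced_behead rw.
all: move: rw; rewrite /fprod_reduced /= nt => /andP[/andP[_ ->]] /=.
all: by case: w.
Qed.

Lemma fprod_consE s w : fprod_reduced (s :: w) -> fprod_cons s w = s :: w.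
Proof.
rewrite /fprod_reduced; case: s w => [a|b] [|[a'|b'] w] //=; rewrite ?andbF //.
all: by move=> /andP[/andP[-> _] _].
Qed.

Lemma fprod_cons1l w : fprod_reduced w -> fprod_cons (inl 1) w = w.
Proof.
case: w => [|[a|b] w] //=; rewrite ?eqxx // mul1g.
by rewrite /fprod_reduced /= -andbA => /andP[/negbTE ->].
Qed.

Lemma fprod_cons1r w : fprod_reduced w -> fprod_cons (inr 1) w = w.
Proof.
case: w => [|[a|b] w] //=; rewrite ?eqxx // mul1g.
by rewrite /fprod_reduced /= -andbA => /andP[/negbTE ->].
Qed.

Lemma fprod_consMl a a' w : fprod_reduced w ->
  fprod_cons (inl a) (fprod_cons (inl a') w) = fprod_cons (inl (a * a')) w.
Proof.
have base u : fprod_reduced u -> (if u is inl _ :: _ then false else true) ->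
    fprod_cons (inl a) (fprod_cons (inl a') u) = fprod_cons (inl (a * a')) u.
  move=> ru hu.
  have E c : fprod_cons (inl c) u = if c == 1 then u else inl c :: u.
    by case: u {ru} hu => [|[d|d] u] //= _; case: eqP.
  rewrite !E; case: (a' =P 1) => [->|_]; first by rewrite mulg1 E.
  by [].
case: w => [|[c|c] w] rw; try exact: base.
have rw' := fprod_reduced_behead rw.
have hw : if w is inl _ :: _ then false else true.
  by move: rw; rewrite /fprod_reduced /=; case: w {rw'} => [|[d|d] w] //=;
    rewrite ?andbF.
have E d : fprod_cons (inl d) w = if d == 1 then w else inl d :: w.
  by case: w {rw rw'} hw => [|[e|e] w] //= _; case: eqP.
rewrite [fprod_cons (inl a') _]/= [RHS]/= -mulgA.
by case: (a' * c =P 1) => [->|_] //; rewrite mulg1 E.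
Qed.

Lemma fprod_consMr b b' w : fprod_reduced w ->
  fprod_cons (inr b) (fprod_cons (inr b') w) = fprod_cons (inr (b * b')) w.
Proof.
have base u : fprod_reduced u -> (if u is inr _ :: _ then false else true) ->
    fprod_cons (inr b) (fprod_cons (inr b') u) = fprod_cons (inr (b * b')) u.
  move=> ru hu.
  have E c : fprod_cons (inr c) u = if c == 1 then u else inr c :: u.
    by case: u {ru} hu => [|[d|d] u] //= _; case: eqP.
  rewrite !E; case: (b' =P 1) => [->|_]; first by rewrite mulg1 E.
  by [].
case: w => [|[c|c] w] rw; try exact: base.
have rw' := fprod_reduced_behead rw.
have hw : if w is inr _ :: _ then false else true.
  by move: rw; rewrite /fprod_reduced /=; case: w {rw'} => [|[d|d] w] //=;
    rewrite ?andbF.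
have E d : fprod_cons (inr d) w = if d == 1 then w else inr d :: w.
  by case: w {rw rw'} hw => [|[e|e] w] //= _; case: eqP.
rewrite [fprod_cons (inr b') _]/= [RHS]/= -mulgA.
by case: (b' * c =P 1) => [->|_] //; rewrite mulg1 E.
Qed.

Definition fprod_mulw u v := foldr fprod_cons v u.

Lemma fprod_mulw_reduced u v : fprod_reduced v -> fprod_reduced (fprod_mulw u v).
Proof. by move=> rv; elim: u => //= s u; apply: fprod_cons_reduced. Qed.

Lemma fprod_mulw_cons s u v : fprod_reduced v ->
  fprod_mulw (fprod_cons s u) v = fprod_cons s (fprod_mulw u v).
Proof.
move=> rv; have ruv u' := fprod_mulw_reduced u' rv.
have mulE t u' : fprod_mulw (t :: u') v = fprod_cons t (fprod_mulw u' v) by [].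
case: s u => [a|b] [|[a'|b'] u]; rewrite [X in fprod_mulw X v = _]/=.
all: try by [case: (a =P 1) => [->|_] //; rewrite fprod_cons1l
            |case: (b =P 1) => [->|_] //; rewrite fprod_cons1r].
- rewrite mulE fprod_consMl //.
  by case: (a * a' =P 1) => [->|_] //; rewrite fprod_cons1l.
- rewrite mulE fprod_consMr //.
  by case: (b * b' =P 1) => [->|_] //; rewrite fprod_cons1r.
Qed.

Lemma fprod_invw_reduced w :
  fprod_reduced w -> fprod_reduced (rev (map syl_inv w)).
Proof.
rewrite /fprod_reduced all_rev all_map rev_sorted sorted_map => /andP[nt alt].
apply/andP; split.
  by apply: sub_all nt => -[a|b] /=; rewrite invg_eq1.
by apply: sub_sorted alt => -[a|b] [a'|b'].
Qed.

Definition fprod_one := FreeProduct (isT : fprod_reduced [::]).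
Definition fprod_mul (u v : free_product) :=
  FreeProduct (fprod_mulw_reduced (fprod_word u) (fprod_wordP v)).
Definition fprod_inv (u : free_product) :=
  FreeProduct (fprod_invw_reduced (fprod_wordP u)).

Lemma fprod_mulA : associative fprod_mul.
Proof.
move=> u v [w rw]; apply/val_inj; case: u => u ru /=; elim: u {ru} => //= s u ->.
by rewrite fprod_mulw_cons.
Qed.

Lemma fprod_mul1 : left_id fprod_one fprod_mul.
Proof. by move=> u; apply/val_inj. Qed.

Lemma fprod_mulr1 : right_id fprod_one fprod_mul.
Proof.
move=> [u ru]; apply/val_inj => /=; elim: u ru => //= s u IHu ru.
by rewrite IHu ?fprod_consE //; apply: fprod_reduced_behead ru.
Qed.

Lemma fprod_mulV : left_inverse fprod_one fprod_inv fprod_mul.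
Proof.
move=> [u ru]; apply/val_inj => /=; elim: u ru => //= s u IHu ru.
rewrite rev_cons /fprod_mulw foldr_rcons.
have -> : fprod_cons (syl_inv s) (s :: u) = u.
  by case: s {ru} => c /=; rewrite mulVg eqxx.
by apply: IHu; apply: fprod_reduced_behead ru.
Qed.

Lemma fprod_mulrV : right_inverse fprod_one fprod_inv fprod_mul.
Proof.
move=> u; have {1}<- : fprod_inv (fprod_inv u) = u; last exact: fprod_mulV.
apply/val_inj; rewrite /= map_rev revK -map_comp map_id_in // => -[c|c] _ /=;
  by rewrite invgK.
Qed.

HB.instance Definition _ := isGroup.Build free_product
  fprod_mulA fprod_mul1 fprod_mulr1 fprod_mulV fprod_mulrV.

Definition fprod_inl (a : A) : free_product :=
  FreeProduct (fprod_cons_reduced (inl a) (isT : fprod_reduced [::])).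
Definition fprod_inr (b : B) : free_product :=
  FreeProduct (fprod_cons_reduced (inr b) (isT : fprod_reduced [::])).

Lemma fprod_inl_morphism : monoid_morphism fprod_inl.
Proof.
split=> [|a a']; apply/val_inj; first by rewrite /= eqxx.
by rewrite [RHS]fprod_mulw_cons ?fprod_cons_reduced // [RHS]fprod_consMl.
Qed.

Lemma fprod_inr_morphism : monoid_morphism fprod_inr.
Proof.
split=> [|b b']; apply/val_inj; first by rewrite /= eqxx.
by rewrite [RHS]fprod_mulw_cons ?fprod_cons_reduced // [RHS]fprod_consMr.
Qed.

Definition fprod_lift (K : groupType) (f : A -> K) (g : B -> K)
    (w : free_product) : K :=
  \prod_(s <- fprod_word w) (match s with inl a => f a | inr b => g b end).

Lemma fprod_lift_morphism (K : groupType) (f : A -> K) (g : B -> K) :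
  monoid_morphism f -> monoid_morphism g -> monoid_morphism (fprod_lift f g).
Proof.
move=> [f1 fM] [g1 gM]; rewrite /fprod_lift.
split=> [|[u ru] [v rv]] /=; first by rewrite big_nil.
elim: u ru => [|s u IHu] ru /=; first by rewrite big_nil mul1g.
rewrite big_cons -mulgA -IHu; last exact: fprod_reduced_behead ru.
case: s {ru IHu} => c; case: (fprod_mulw u v) => [|[d|d] w] /=;
  case: eqP => [e|_]; rewrite ?big_cons /= ?mulgA -?fM -?gM ?e ?f1 ?g1 ?mul1g //.
Qed.

Lemma fprod_lift_inl (K : groupType) (f : A -> K) (g : B -> K) :
  monoid_morphism f -> fprod_lift f g \o fprod_inl =1 f.
Proof.
move=> [f1 _] a; rewrite /fprod_lift /=.
by case: eqP => [->|_]; rewrite ?big_nil ?big_seq1.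
Qed.

Lemma fprod_lift_inr (K : groupType) (f : A -> K) (g : B -> K) :
  monoid_morphism g -> fprod_lift f g \o fprod_inr =1 g.
Proof.
move=> [g1 _] b; rewrite /fprod_lift /=.
by case: eqP => [->|_]; rewrite ?big_nil ?big_seq1.
Qed.

Lemma fprod_lift_unique (K : groupType) (f : A -> K) (g : B -> K)
    (h : free_product -> K) :
  monoid_morphism h -> h \o fprod_inl =1 f -> h \o fprod_inr =1 g ->
  h =1 fprod_lift f g.
Proof.
move=> [h1 hM] hf hg [w rw]; rewrite /fprod_lift /=.
elim: w rw => [|s w IHw] rw.
  by rewrite big_nil -h1; congr h; apply/val_inj.
have rw' := fprod_reduced_behead rw.
rewrite big_cons -(IHw rw').
have -> : FreeProduct rw =
    (match s with inl a => fprod_inl a | inr b => fprod_inr b end)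
      * FreeProduct rw'.
  apply/val_inj; rewrite -[LHS](fprod_consE rw).
  by case: s {rw IHw} => c; rewrite [RHS]fprod_mulw_cons.
by rewrite hM; case: s {rw IHw} => c; rewrite -?hf -?hg.
Qed.

End FreeProduct.

Definition set_mul (M : monoidType) (L1 L2 : set M) : set M :=
  [set z | exists2 a, L1 a & exists2 b, L2 b & z = a * b].

Definition submonoid (M : monoidType) (S : set M) : Prop :=
  S 1 /\ (forall a b, S a -> S b -> S (a * b)).

Definition set_star (M : monoidType) (L : set M) : set M :=
  smallest (@submonoid M) L.

Inductive rational (M : monoidType) : set M -> Prop :=
| rational_finite (L : set M) : finite_set L -> rational L
| rational_union (L1 L2 : set M) :
    rational L1 -> rational L2 -> rational (L1 `|` L2)
| rational_mul (L1 L2 : set M) :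
    rational L1 -> rational L2 -> rational (set_mul L1 L2)
| rational_star (L : set M) : rational L -> rational (set_star L).

Definition rat_boolean_algebra (M : monoidType) : Prop :=
  (forall L1 L2 : set M, rational L1 -> rational L2 -> rational (L1 `&` L2)) /\
  (forall L : set M, rational L -> rational (~` L)).

Definition infinite_order (G : groupType) (x : G) : Prop :=
  forall n, (0 < n)%N -> x ^+ n != 1.

(* groupType includes a choiceType structure on the carrier; classically every
   group admits one, so quantifying over groupType ranges over all groups. *)

Definition word := free_group nat.

Definition word_values (w : word) (G : groupType) : set G :=
  range (fun g : nat -> G => free_eval g w).
Arguments word_values : clear implicits.

Definition proper_word (w : word) : Prop :=
  (exists G : groupType, word_values w G <> [set 1]) /\
  (exists H : groupType, word_values w H <> [set: H]).

(* Main.v *)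
Require Import Defs.
From mathcomp Require Import all_boot ssralg ssrnum ssrint intdiv.
From mathcomp Require Import boolp classical_sets functions cardinality.
From mathcomp Require Import ring lra zify.

Set Implicit Arguments.
Unset Strict Implicit.
Unset Printing Implicit Defensive.

Import GRing.Theory Num.Theory.
Local Open Scope group_scope.

(** Two properties of subsets of G = A * B are played against each other.

    A rational set R is finitely cut: there are finitely many pairs of sets
    (U_k, V_k) with U_k V_k contained in R such that whenever the normal form
    of an element of R is cut in two, g = h h', some k has h in U_k and h' in
    V_k (rational_finitely_cut).  The proof is by induction on R, with no
    finite automaton: in the Cayley graph of G over the generators A and B,
    every inner vertex on the normal form of g is a cut vertex, so a cut point of
    g1 g2 is already a cut point of g1 or of g2 (reduced_split_cut).  By the
    pigeonhole principle, among enough elements h_i h_i' of R cut in this way,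
    two of them can exchange their tails without leaving R.

    The values of w, on the other hand, obey a divisibility constraint.  Let
    f_n(g) be the number of syllables x1^(n+1) of g minus the number of
    syllables x1^-(n+1).  In a product g h, whatever cancels at the junction
    cancels also in f_n(g) + f_n(h), and after the cancellation at most one
    pair of syllables a, a' merges into a a'.  These three elements of A are
    powers x1^(n+1) or x1^-(n+1) for at most three n, so f_n is additive on g, h
    for all but three n (power_countM).  Iterating over the letters of w, f_n
    of the value w(g) is the sum of t_i f_n(g_i), where t_i is the exponent sum
    of the i-th variable, for all but c = 3|w| indices n; it is then divisible
    by e(w).

    Finally, sending one variable with t_i != 0 to h or its inverse and all
    others to 1 shows that w[G] contains all powers h^(d+1), for some fixed d.
    Take for h the elements
      u_i = x1^(n_1) x2 x1^(n_2) x2 ... x1^(n_(c+1)) x2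
    where all exponents are distinct, also for different i.  If w[G] were rational,
    exchanging tails in two of the powers u_i u_i^d and u_j u_j^d would put
    u_i u_j^d in w[G], although f_n takes the value 1 on it for the c + 1
    indices n coming from u_i, which is impossible when e(w) >= 2. *)

(** * Cutting normal forms in a free product *)

Section FreeProductWords.
Variables A B : groupType.
Local Notation G := (free_product A B).
Implicit Types (s t : A + B) (u v w : seq (A + B)) (g h : G).

Lemma fprod_mulwE u v : fprod_reduced (u ++ v) -> fprod_mulw u v = u ++ v.
Proof.
elim: u => //= s u IHu r.
by rewrite IHu ?fprod_consE //; apply: fprod_reduced_behead r.
Qed.

Lemma fprod_reduced_cat u v :
  fprod_reduced (u ++ v) -> fprod_reduced u /\ fprod_reduced v.
Proof.
rewrite /fprod_reduced all_cat => /andP[/andP[-> ->]] /= /cat_sorted2[-> ->].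
by [].
Qed.

Lemma fprod_reduced_cons2 s t w :
  fprod_reduced (s :: t :: w) -> syl_left s != syl_left t.
Proof. by rewrite /fprod_reduced /= => /andP[_ /andP[]]. Qed.

(** The left and right factors play symmetric roles; this disjunction treats
    both at once: the new syllable is put in front, or it meets a syllable t
    from the same factor, which it cancels or replaces. *)
Lemma fprod_cons_cases s w : syl_nontrivial s ->
  fprod_cons s w = s :: w \/
  exists2 t, syl_left t = syl_left s &
  exists2 w', w = t :: w' & fprod_cons s w = w' \/
    exists2 t', syl_left t' = syl_left s & fprod_cons s w = t' :: w'.
Proof.
case: s => c; case: w => [|[d|d] w] /= nt; rewrite ?nt; try by left.
  right; exists (inl d) => //; exists w => //.
  by case: eqP; [left | right; exists (inl (c * d))].
right; exists (inr d) => //; exists w => //.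
by case: eqP; [left | right; exists (inr (c * d))].
Qed.

(** The cut vertex property of the Cayley graph: each vertex of the normal form
    of a product is visited while spelling the first factor or the second. *)
Lemma fprod_mulw_cut u v w1 w2 : fprod_reduced w1 ->
  fprod_mulw w1 w2 = u ++ v ->
  (exists x, w1 = u ++ x) \/ (exists y, w2 = y ++ v).
Proof.
elim: w1 u => [|s w1 IH] u r1 /=; first by move=> ->; right; exists u.
case: u => [|t u]; first by left; exists (s :: w1).
have nt : syl_nontrivial s by case/andP: r1 => /andP[].
have r1' := fprod_reduced_behead r1.
(* If s merges with the first syllable of the product of w1 and w2, that
   syllable cannot come from w1, since s :: w1 alternates: the cut is in w2. *)
have clash t' u' : syl_left t' = syl_left s ->
    fprod_mulw w1 w2 = (t' :: u') ++ v -> exists y, w2 = y ++ v.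
  move=> tt' /(IH _ r1')[[x E]|//]; move: r1; rewrite E => /fprod_reduced_cons2.
  by rewrite tt' eqxx.
have [->|[t' tt' [w' E [->|[t2 _ ->]]]]] := fprod_cons_cases (fprod_mulw w1 w2) nt.
- case=> <- /(IH _ r1')[[x ->]|]; [by left; exists x | by right].
- by move=> /= E'; right; apply: (clash t' (t :: u)) => //; rewrite E E'.
- by case=> _ E'; right; apply: (clash t' u) => //; rewrite E E'.
Qed.

Definition reduced_split g h k := fprod_word g = fprod_word h ++ fprod_word k.

Lemma reduced_split_mul g h k : reduced_split g h k -> g = h * k.
Proof.
move=> E; apply/val_inj; rewrite /= E fprod_mulwE // -E; exact: fprod_wordP.
Qed.

Lemma reduced_split_cut g1 g2 h k : reduced_split (g1 * g2) h k ->
  (exists2 x, reduced_split g1 h x & k = x * g2) \/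
  (exists2 y, reduced_split g2 y k & h = g1 * y).
Proof.
move=> E; have Eg := reduced_split_mul E.
case: (fprod_mulw_cut (fprod_wordP g1) E) => -[z Ez].
  have [_ rz] : fprod_reduced (fprod_word h) /\ fprod_reduced z.
    by apply: fprod_reduced_cat; rewrite -Ez; apply: fprod_wordP.
  left; exists (FreeProduct rz) => //; apply: (mulgI h).
  by rewrite -Eg mulgA; congr (_ * _); apply: reduced_split_mul.
have [rz _] : fprod_reduced z /\ fprod_reduced (fprod_word k).
  by apply: fprod_reduced_cat; rewrite -Ez; apply: fprod_wordP.
right; exists (FreeProduct rz) => //; apply: (mulIg k).
by rewrite -Eg -mulgA; congr (_ * _); apply: reduced_split_mul.
Qed.

(** * Rational subsets of a free product are finitely cut *)

Local Open Scope classical_set_scope.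

(** For a subset of a free monoid, this would say that finitely many residuals
    describe all the ways to complete a prefix, as in a finite automaton. *)
Definition finitely_cut (R : set G) :=
  exists (K : finType) (U V : K -> set G),
    (forall k, set_mul (U k) (V k) `<=` R) /\
    (forall g h h', R g -> reduced_split g h h' -> exists k, U k h /\ V k h').

Lemma finitely_cut1 g : finitely_cut [set g].
Proof.
exists 'I_(size (fprod_word g)).+1,
  (fun k : 'I__ => [set h | fprod_word h = take k (fprod_word g)]),
  (fun k : 'I__ => [set h | fprod_word h = drop k (fprod_word g)]); split.
  move=> k _ [h /= Eh [h' /= Eh' ->]]; apply/esym/reduced_split_mul.
  by rewrite /reduced_split Eh Eh' cat_take_drop.
move=> _ h h' -> E.
have lt : (size (fprod_word h) < (size (fprod_word g)).+1)%N.
  by rewrite E size_cat ltnS leq_addr.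
by exists (Ordinal lt) => /=; rewrite E take_size_cat ?drop_size_cat.
Qed.

Lemma finitely_cutU (R1 R2 : set G) :
  finitely_cut R1 -> finitely_cut R2 -> finitely_cut (R1 `|` R2).
Proof.
move=> [K1 [U1 [V1 [s1 c1]]]] [K2 [U2 [V2 [s2 c2]]]].
exists (K1 + K2)%type,
  (fun k => match k with inl k => U1 k | inr k => U2 k end),
  (fun k => match k with inl k => V1 k | inr k => V2 k end).
split; first by case=> k g; [move/s1; left | move/s2; right].
move=> g h h' [Rg|Rg] E.
- by have [k] := c1 _ _ _ Rg E; exists (inl k).
- by have [k] := c2 _ _ _ Rg E; exists (inr k).
Qed.

Lemma finitely_cutM (R1 R2 : set G) :
  finitely_cut R1 -> finitely_cut R2 -> finitely_cut (set_mul R1 R2).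
Proof.
move=> [K1 [U1 [V1 [s1 c1]]]] [K2 [U2 [V2 [s2 c2]]]].
exists (K1 + K2)%type,
  (fun k => match k with inl k => U1 k | inr k => set_mul R1 (U2 k) end),
  (fun k => match k with inl k => set_mul (V1 k) R2 | inr k => V2 k end).
split=> [|z h h' [g1 Rg1 [g2 Rg2 ->]] /reduced_split_cut]; first case=> k z /=.
- move=> [h Uh [_ [x Vx [g2 Rg2 ->]] ->]]; rewrite mulgA.
  by exists (h * x); [apply: (s1 k); exists h => //; exists x | exists g2].
- move=> [_ [g1 Rg1 [y Uy ->]] [h Vh ->]]; rewrite -mulgA.
  by exists g1 => //; exists (y * h) => //; apply: (s2 k); exists y => //; exists h.
- case=> [[x E ->]|[y E ->]].
    have [k [Uh Vx]] := c1 _ _ _ Rg1 E.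
    by exists (inl k); split=> //; exists x => //; exists g2.
  have [k [Uy Vh]] := c2 _ _ _ Rg2 E.
  by exists (inr k); split=> //; exists g1 => //; exists y.
Qed.

Lemma set_star_submonoid (R : set G) : submonoid (set_star R).
Proof.
split=> [S [[]]//|g h Rg Rh S HS].
by have [[_ SM] _] := HS; apply: SM; [apply: Rg | apply: Rh].
Qed.

(** A cut of an element of the submonoid generated by R lies inside one factor
    from R, whence the pairs (R^* U_k, V_k R^* ); the additional pair of
    singletons of 1 covers the empty product. *)
Lemma finitely_cut_star (R : set G) :
  finitely_cut R -> finitely_cut (set_star R).
Proof.
move=> [K [U [V [s c]]]]; have [star1 starM] := set_star_submonoid R.
have starS g : R g -> set_star R g by move=> Rg S [_]; apply.
exists (option K),
  (fun k => if k is Some k then set_mul (set_star R) (U k) else [set 1]),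
  (fun k => if k is Some k then set_mul (V k) (set_star R) else [set 1]).
split; first case=> [k|] g /=.
- move=> [_ [g1 Rg1 [h Uh ->]] [_ [h' Vh [g2 Rg2 ->]] ->]].
  rewrite mulgA; apply: (starM) => //; rewrite -mulgA; apply: (starM) => //.
  by apply: starS; apply: (s k); exists h => //; exists h'.
- by move=> [_ -> [_ -> ->]]; rewrite mulg1.
move=> g h h' Rg; move: h h'.
(* The elements all of whose cuts are covered form a submonoid containing R. *)
pose P g := set_star R g /\ forall h h', reduced_split g h h' ->
  exists k : option K,
    (if k is Some k then set_mul (set_star R) (U k) else [set 1]) h /\
    (if k is Some k then set_mul (V k) (set_star R) else [set 1]) h'.
suff [] : P g by [].
apply: (Rg P); split; last first.
  move=> g0 R0; split=> [|h h' E]; first exact: starS.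
  have [k [Uh Vh]] := c _ _ _ R0 E; exists (Some k).
  by split; [exists 1 => //; exists h => //; rewrite mul1g
            |exists h' => //; exists 1 => //; rewrite mulg1].
split=> [|g1 g2 [R1 P1] [R2 P2]].
  split=> // h h' E; exists None.
  have [/nilP Eh /nilP Eh'] : nilp (fprod_word h) /\ nilp (fprod_word h').
    by apply/andP; rewrite -cat_nilp -E.
  by split; apply/val_inj.
split=> [|h h' /reduced_split_cut[[x E ->]|[y E ->]]]; first exact: (starM).
- have [[k|] /= [Uh Vx]] := P1 _ _ E.
    exists (Some k); split=> //; have [x1 Vx1 [x2 Rx2 ->]] := Vx.
    by exists x1 => //; exists (x2 * g2); [apply: (starM) | rewrite mulgA].
  (* The cut of g1 is the empty one, so the cut of g1 * g2 is 1 * g2, which is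
     a cut of the second factor. *)
  rewrite Uh Vx mul1g; have [k Hk] := P2 1 g2 erefl; by exists k.
- have [[k|] /= [Uy Vh]] := P2 _ _ E.
    exists (Some k); split=> //; have [y1 Ry1 [y2 Uy2 ->]] := Uy.
    by exists (g1 * y1); [apply: (starM) | exists y2 => //; rewrite mulgA].
  rewrite Uy Vh mulg1; have [k Hk] := P1 g1 1 (esym (cats0 _)); by exists k.
Qed.

Lemma rational_finitely_cut (R : set G) : rational R -> finitely_cut R.
Proof.
elim=> {R} [L|L1 L2 _ c1 _ c2|L1 L2 _ c1 _ c2|L _ c].
- move=> /finite_seqP[r ->]; elim: r => [|g r IH].
    exists void, (fun _ => set0), (fun _ => set0).
    by split=> [[]|].
  have -> : [set` g :: r] = [set g] `|` [set` r] by apply/seteqP; split=> h /=;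
    rewrite inE => /predU1P.
  by apply: finitely_cutU => //; apply: finitely_cut1.
- exact: finitely_cutU.
- exact: finitely_cutM.
- exact: finitely_cut_star.
Qed.

End FreeProductWords.

(** * Sums over syllables are additive up to one merging *)

Section SyllableSum.
Variables A B : groupType.
Local Notation G := (free_product A B).
Implicit Types (g h : G) (phi : A -> int).
Local Open Scope ring_scope.

Definition word_sum phi (w : seq (A + B)) : int :=
  \sum_(s <- w) (if s is inl a then phi a else 0).

Definition syllable_sum phi g : int := word_sum phi (fprod_word g).

Definition odd_map phi := forall a, phi a^-1%g = - phi a.

Lemma odd_map1 phi : odd_map phi -> phi 1%g = 0.
Proof. by move=> /(_ 1%g); rewrite invg1 => /esym/eqP; rewrite eqNr => /eqP. Qed.

Lemma word_sum_cons phi s w :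
  word_sum phi (s :: w) = (if s is inl a then phi a else 0) + word_sum phi w.
Proof. exact: big_cons. Qed.

(** At most one merging of syllables occurs: once two syllables have merged
    into a nontrivial one, the product starts with a syllable of the same
    factor as w1 does, and longer words s :: w1 do not interact with it.  The
    second alternative records this, as the induction needs it.  The elements a
    and a' are chosen before phi, so that one junction serves all phi. *)
Lemma word_sum_mulw (w1 w2 : seq (A + B)) : fprod_reduced w1 ->
  (forall phi, odd_map phi ->
     word_sum phi (fprod_mulw w1 w2) = word_sum phi w1 + word_sum phi w2) \/
  (exists s w1' t w', [/\ w1 = s :: w1', fprod_mulw w1 w2 = t :: w',
     syl_left s = syl_left t &
   exists a a', forall phi, odd_map phi ->
     word_sum phi (fprod_mulw w1 w2)
       = word_sum phi w1 + word_sum phi w2 + (phi (a * a')%g - phi a - phi a')]).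
Proof.
elim: w1 => [|s w1 IH] r1.
  by left=> phi _; rewrite /word_sum big_nil add0r.
have nt : syl_nontrivial s by case/andP: r1 => /andP[].
have [E|[t [w1' [t' [w' [Ew1 Ew tt' [a [a' E]]]]]]]] := IH (fprod_reduced_behead r1).
  rewrite [fprod_mulw _ _]/=.
  move: (fprod_mulw w1 w2) E => w E.
  have same : fprod_cons s w = s :: w -> (forall phi, odd_map phi ->
     word_sum phi (fprod_cons s w) = word_sum phi (s :: w1) + word_sum phi w2).
    by move=> -> phi o; rewrite !word_sum_cons E // addrA.
  case: s w {r1 IH} nt E same => [c|c] [|[d|d] w] nt E same;
    try by left; apply: same; rewrite /= (negbTE nt).
  - rewrite [fprod_cons _ _]/=; case: eqP => [cd|_].
      left=> phi o; rewrite word_sum_cons -addrA -E // word_sum_cons /=.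
      have -> : d = c^-1%g by apply: (mulgI c); rewrite cd mulgV.
      by rewrite o; ring.
    right; exists (inl c), w1, (inl (c * d)%g), w; split=> //.
    by exists c, d => phi o; move: (E phi o); rewrite !word_sum_cons /=; lra.
  - rewrite [fprod_cons _ _]/=; case: eqP => [_|_].
      left=> phi o; rewrite word_sum_cons -addrA -E //.
      by rewrite word_sum_cons /= !add0r.
    right; exists (inr c), w1, (inr (c * d)%g), w; split=> //.
    (* Merging inside B is invisible to phi. *)
    exists 1%g, 1%g => phi o; rewrite mulg1 odd_map1 //.
    by move: (E phi o); rewrite !word_sum_cons /=; lra.
right; exists s, w1, s, (fprod_mulw w1 w2).
have Es : fprod_cons s (fprod_mulw w1 w2) = s :: fprod_mulw w1 w2.
  have : syl_left s != syl_left t'.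
    by rewrite -tt'; move: r1; rewrite Ew1; apply: fprod_reduced_cons2.
  rewrite Ew; case: s nt {r1} => [c|c] nt; case: (t') => [d|d] //=;
    by rewrite (negbTE nt).
split=> //; exists a, a' => phi o; rewrite [fprod_mulw _ _]/= Es.
by rewrite !word_sum_cons E // !addrA.
Qed.

Lemma syllable_sumM g h : exists a a', forall phi, odd_map phi ->
  syllable_sum phi (g * h)%g
    = syllable_sum phi g + syllable_sum phi h + (phi (a * a')%g - phi a - phi a').
Proof.
have [E|[_ [_ [_ [_ [_ _ _ E]]]]]] := word_sum_mulw (fprod_word h) (fprod_wordP g).
  (* Without merging, a = a' = 1 gives a zero defect, as phi vanishes at 1. *)
  exists 1%g, 1%g => phi o; rewrite mulg1 odd_map1 // !subr0.
  exact: E.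
exact: E.
Qed.

Lemma syllable_sumV phi g : odd_map phi ->
  syllable_sum phi g^-1%g = - syllable_sum phi g.
Proof.
move=> o; rewrite /syllable_sum /word_sum /= (perm_big _ (permEl (perm_rev _))).
rewrite big_map -sumrN; apply: eq_bigr => -[a|b] _ /=; [exact: o|].
by rewrite oppr0.
Qed.

End SyllableSum.

(** * Counting powers of an element of infinite order *)

Definition all_but (c : nat) (P : nat -> Prop) :=
  exists2 E : seq nat, (size E <= c)%N & forall n, n \notin E -> P n.

Lemma all_but0 (P : nat -> Prop) : (forall n, P n) -> all_but 0 P.
Proof. by exists [::]. Qed.

Lemma all_butI c d (P Q S : nat -> Prop) : all_but c P -> all_but d Q ->
  (forall n, P n -> Q n -> S n) -> all_but (c + d) S.
Proof.
move=> [E sE P_] [F sF Q_] PQS; exists (E ++ F); first by rewrite size_cat leq_add.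
by move=> n; rewrite mem_cat negb_or => /andP[/P_ Pn /Q_ Qn]; apply: PQS.
Qed.

Section PowerCount.
Variables (A B : groupType) (x : A).
Hypothesis x_inf : infinite_order x.
Local Notation G := (free_product A B).
Implicit Types (g h : G) (a : A).
Local Open Scope ring_scope.

(** The index n stands for the exponent n + 1, so that all natural numbers are
    admissible indices. *)
Definition power_sign n a : int :=
  (a == x ^+ n.+1)%g%:R - (a^-1 == x ^+ n.+1)%g%:R.

Definition power_count n g : int := syllable_sum (power_sign n) g.

Lemma odd_power_sign n : odd_map (power_sign n).
Proof. by move=> a; rewrite /power_sign invgK opprB. Qed.

Lemma infinite_order_inj m n : (x ^+ m = x ^+ n)%g -> m = n.
Proof.
wlog lt : m n / (m < n)%N.
  by move=> W E; case: (ltngtP m n) => // lt; [|apply/esym]; apply: W.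
move=> E; have n0 : (0 < n - m)%N by rewrite subn_gt0.
case/eqP: (x_inf n0); apply: (mulgI (x ^+ m)%g).
by rewrite -expgnDr subnKC ?mulg1 // ltnW.
Qed.

Lemma infinite_order_invX m n : ((x ^+ m)^-1 = x ^+ n)%g -> m = 0%N.
Proof.
move=> E; suff : (m + n = 0)%N by move/eqP; rewrite addn_eq0 => /andP[/eqP].
by apply: infinite_order_inj; rewrite expgnDr -E mulgV expg0.
Qed.

Lemma power_signX m n : power_sign m (x ^+ n.+1)%g = (m == n)%:R.
Proof.
rewrite /power_sign; case: (_^-1 =P _)%g => [/infinite_order_invX//|_].
rewrite subr0; congr (nat_of_bool _)%:R.
by apply/eqP/eqP => [/infinite_order_inj[]|->].
Qed.

Lemma power_sign_all_but a : all_but 1 (fun n => power_sign n a = 0).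
Proof.
have [[m H]|H] := pselect (exists m, power_sign m a != 0); last first.
  exists [::] => // n _; apply/eqP/negP => /negP Hn; by apply: H; exists n.
exists [:: m] => // n; rewrite inE => /negbTE nm; move: H.
have [-> _|na] := eqVneq a (x ^+ m.+1)%g.
  by rewrite power_signX nm.
have [E _|na'] := eqVneq a^-1%g (x ^+ m.+1)%g.
  by rewrite -[a]invgK odd_power_sign E power_signX nm oppr0.
by rewrite /power_sign (negbTE na) (negbTE na') subrr eqxx.
Qed.

(** Only the three syllables a, a' and a * a' at the junction contribute to
    the defect, and each of them is seen by a single index. *)
Lemma power_countM g h : all_but 3 (fun n =>
  power_count n (g * h)%g = power_count n g + power_count n h).
Proof.
have [a [a' E]] := syllable_sumM g h.
apply: (all_butI (c := 1) (d := 2)).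
- exact: (power_sign_all_but (a * a')%g).
- by apply: (all_butI (power_sign_all_but a) (power_sign_all_but a')) => n; exact: conj.
move=> n E0 [E1 E2]; rewrite /power_count E; last exact: odd_power_sign.
by rewrite E0 E1 E2; ring.
Qed.

Lemma power_countV n g : power_count n g^-1%g = - power_count n g.
Proof. exact/syllable_sumV/odd_power_sign. Qed.

(** Evaluating w multiplies |w| elements, each multiplication costing at most
    three indices; the bound depends on w alone, not on the values f. *)
Lemma power_count_eval (X : choiceType) (f : X -> G) (w : free_group X) :
  all_but (3 * size (free_word w)) (fun n =>
    power_count n (free_eval f w)
      = \sum_(l <- free_word w) (-1) ^+ l.2 * power_count n (f l.1)).
Proof.
rewrite /free_eval; elim: (free_word w) => [|l r IH].
  apply: all_but0 => n; rewrite !big_nil.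
  by rewrite /power_count /syllable_sum /word_sum big_nil.
rewrite mulnS big_cons; set g := if l.2 then _ else _; set h := (\prod_(_ <- r) _)%g.
apply: (all_butI (power_countM g h) IH) => n -> ->.
rewrite big_cons /g; congr (_ + _); case: l.2; last by rewrite expr0 mul1r.
by rewrite power_countV expr1 mulN1r.
Qed.

End PowerCount.

(** * Exponent sums *)

Section ExponentGcd.
Variable X : choiceType.
Implicit Types w : free_group X.
Local Open Scope ring_scope.

Lemma dvd_exponent_gcd w l : l \in free_word w ->
  (exponent_gcd w %| exponent_sum w l.1)%Z.
Proof.
rewrite /exponent_gcd; move: (exponent_sum w) => t; rewrite dvdzE /=.
elim: (free_word w) => // m r IH; rewrite inE big_cons => /predU1P[->|/IH H].
  exact: dvdn_gcdl.
exact: dvdn_trans (dvdn_gcdr _ _) H.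
Qed.

Lemma sum_exponent_sum w (c : X -> int) :
  \sum_(l <- free_word w) (-1) ^+ l.2 * c l.1
    = \sum_(y <- undup (map fst (free_word w))) exponent_sum w y * c y.
Proof.
rewrite /exponent_sum; under [RHS]eq_bigr => y _ do rewrite mulr_suml.
under [RHS]eq_bigr => y _ do rewrite big_mkcond /=.
rewrite exchange_big big_seq [RHS]big_seq; apply: eq_bigr => l lw.
rewrite (bigD1_seq l.1) ?undup_uniq ?mem_undup ?map_f //= eqxx.
by rewrite big1 ?addr0 // => y; rewrite eq_sym => /negbTE ->.
Qed.

Lemma dvd_signed_sum w (c : X -> int) :
  (exponent_gcd w %| \sum_(l <- free_word w) (-1) ^+ l.2 * c l.1)%Z.
Proof.
rewrite sum_exponent_sum big_seq.
apply: (big_ind (fun s => (exponent_gcd w %| s)%Z)); first exact: dvdz0.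
  exact: rpredD.
move=> y; rewrite mem_undup => /mapP[l lw ->].
by apply: dvdz_mulr; apply: dvd_exponent_gcd.
Qed.

Lemma exponent_gcd_eq0 w :
  (forall l, l \in free_word w -> exponent_sum w l.1 = 0) -> exponent_gcd w = 0%N.
Proof. by move=> H; rewrite /exponent_gcd big_seq big1 // => l /H ->. Qed.

(** Evaluation at a single nontrivial variable is h to the exponent sum; moving
    the inverse letters to the left-hand side avoids negative powers. *)
Lemma free_eval_single (G : groupType) (h : G) (y : X) w :
  (free_eval (fun z => if z == y then h else 1) w
     * h ^+ count_mem (y, true) (free_word w))%g
    = (h ^+ count_mem (y, false) (free_word w))%g.
Proof.
have comm n (r : seq (X * bool)) :
    let f z := if z == y then h else 1%g in
    commute (\prod_(l <- r) (if l.2 then (f l.1)^-1 else f l.1))%g (h ^+ n)%g.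
  rewrite /=; apply/commute_sym/commute_prod => l _; apply/commute_sym/commuteX.
  by case: l => z []; case: eqP => _ /=; rewrite ?invg1; apply/commute_sym;
    do ?[apply: commuteV]; rewrite /commute ?mulg1 ?mul1g.
rewrite /free_eval /=; elim: (free_word w) => [|[z b] r IH] /=.
  by rewrite big_nil mulg1.
rewrite big_cons -mulgA /=.
case: b; rewrite !xpair_eqE /= ?andbT ?andbF ?add0n; case: eqP => _ /=;
  rewrite ?invg1 ?mul1g ?add0n //.
  by rewrite comm expgnDr expg1 -mulgA mulKg -comm.
by rewrite IH expgnDr expg1.
Qed.

Lemma exponent_sum_count w y :
  exponent_sum w y
    = (count_mem (y, false) (free_word w))%:Z - (count_mem (y, true) (free_word w))%:Z.
Proof.
rewrite /exponent_sum; elim: (free_word w) => [|[z b] r IH]; first by rewrite big_nil.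
rewrite big_cons /= IH !xpair_eqE; case: eqP => _ //=.
by case: b => /=; rewrite ?expr0 ?expr1 ?andbT; lia.
Qed.

End ExponentGcd.

(** Some exponent sum is nonzero, and its absolute value is d + 1. *)
Lemma word_values_power (G : groupType) (w : word) : exponent_gcd w != 0%N ->
  exists d, forall h : G, word_values w G (h ^+ d.+1)%g.
Proof.
move=> gcd0; have [y y0] : exists y, exponent_sum w y != 0%R.
  apply: contrapT => H; case/eqP: gcd0; apply: exponent_gcd_eq0 => l _.
  by apply/eqP/negP => /negP H'; apply: H; exists l.1.
move: y0; rewrite exponent_sum_count subr_eq0 eqz_nat.
pose f h z : G := if z == y then h else 1.
have := fun h => @free_eval_single _ G h y w; rewrite -/(f _).
set p := count_mem _ _; set q := count_mem _ _ => E pq.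
(* p and q count the letters y^-1 and y; the sign of q - p decides between h
   and its inverse. *)
have [lt|le] := ltnP p q.
  exists (q - p).-1 => h; exists (f h) => //; rewrite prednK ?subn_gt0 //.
  by apply: (mulIg (h ^+ p)); rewrite E -expgnDr subnK // ltnW.
have lt : (q < p)%N by rewrite ltn_neqAle pq.
exists (p - q).-1 => h; exists (f h^-1) => //; rewrite prednK ?subn_gt0 //.
apply: (mulIg (h^-1 ^+ p)); rewrite E -{2}(subnK le) expgnDr mulgA.
by rewrite -expgMn ?mulgV ?expg1n ?mul1g //; apply/commuteV/commute_refl.
Qed.

(** * Alternating products and the theorem *)

Section Blocks.
Variables (A B : groupType) (x1 : A) (x2 : B).
Hypotheses (x1_inf : infinite_order x1) (x2_neq1 : x2 != 1).
Local Notation G := (free_product A B).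
Implicit Types js ks : seq nat.

Definition alternating_word js : seq (A + B) :=
  flatten [seq [:: inl (x1 ^+ j.+1); inr x2] | j <- js].

Lemma alternating_reduced js : fprod_reduced (alternating_word js).
Proof.
rewrite /fprod_reduced; elim: js => //= j js /andP[-> so].
rewrite x1_inf // x2_neq1 /=.
by case: js so => //= k js ->.
Qed.

Definition alternating js : G := FreeProduct (alternating_reduced js).

Lemma alternating_split js ks :
  reduced_split (alternating (js ++ ks)) (alternating js) (alternating ks).
Proof. by rewrite /reduced_split /= /alternating_word map_cat flatten_cat. Qed.

Lemma alternating_cat js ks :
  alternating (js ++ ks) = alternating js * alternating ks.
Proof. exact/reduced_split_mul/alternating_split. Qed.

Lemma alternatingX d js :
  alternating js ^+ d = alternating (flatten (nseq d js)).
Proof.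
elim: d => [|d IH]; first by apply/val_inj.
by rewrite expgS IH -alternating_cat.
Qed.

Lemma power_count_alternating n js :
  power_count x1 n (alternating js) = count_mem n js.
Proof.
rewrite /power_count /syllable_sum /=; elim: js => [|j js IH].
  by rewrite /word_sum big_nil.
rewrite !word_sum_cons IH power_signX // add0r /=.
by rewrite eq_sym; case: (j == n).
Qed.

End Blocks.

Theorem theorem5p7 (A B : groupType) (x1 : A) (x2 : B)
    (hx1 : infinite_order x1) (hx2 : infinite_order x2)
    (hA : rat_boolean_algebra A) (hB : rat_boolean_algebra B)
    (w : word) (hw : proper_word w) (he : (2 <= exponent_gcd w)%N) :
  ~ rational (word_values w (free_product A B)).
Proof.
move=> /rational_finitely_cut[K [U [V [sub cut]]]].
have x2_neq1 : x2 != 1 by rewrite -[x2]expg1 hx2.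
pose c := (3 * size (free_word w))%N.
(* Disjoint blocks of c + 1 indices, one more than the number of exceptions
   that a value of w may have. *)
pose blk i := iota (i * c.+1) c.+1.
pose u i := alternating hx1 x2_neq1 (blk i).
have [d dP] := @word_values_power (free_product A B) w (lt0n_neq0 (ltnW he)).
have /choice[k kP] i : exists k, U k (u i) /\ V k (u i ^+ d).
  apply: (cut _ _ _ (dP (u i))); rewrite expgS /u alternatingX -alternating_cat.
  exact: alternating_split.
have [i [j [ij kij]]] : exists i j, i != j /\ k i = k j.
  pose k' (i : 'I_#|K|.+1) := k i.
  have /injectivePn[i [j ij kij]] : ~~ injectiveb k'.
    by apply/negP => /injectiveP/leq_card; rewrite card_ord ltnn.
  by exists (i : nat), (j : nat).
(* The head of the i-th power followed by the tail of the j-th one. *)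
have [g _ gE] : word_values w _ (u i * u j ^+ d).
  apply: (sub (k i)); exists (u i); first by case: (kP i).
  by exists (u j ^+ d) => //; rewrite kij; case: (kP j).
have [E sE nE] := power_count_eval hx1 g w.
have /allPn[n ni nE'] : ~~ all (mem E) (blk i).
  apply/negP => /allP/(uniq_leq_size (iota_uniq _ _)); rewrite size_iota.
  by rewrite leqNgt ltnS sE.
have nj : n \notin blk j.
  apply: contraNN ij => nj; move: ni nj; rewrite !mem_iota; nia.
have := nE n nE'; rewrite gE /u alternatingX -alternating_cat.
rewrite power_count_alternating count_cat count_uniq_mem ?iota_uniq // ni.
have /count_memPn -> : n \notin flatten (nseq d (blk j)).
  by apply/negP => /flattenP[r /nseqP[-> _]]; apply/negP.
move=> sum1; have := dvd_signed_sum w (fun y => power_count x1 n (g y)).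
by rewrite -sum1 dvdzE /= dvdn1 => /eqP e1; rewrite e1 in he.
Qed.
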